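(* (Associativity.) Let $\mathbf C$ be a cancellative atomic Markov category with conditionals. If $f:X\otimes(U\otimes V)\to Y\otimes(U\otimes V)$ is traceable (with respect to $U\otimes V$), then so are $f:(X\otimes U)\otimes V\to(Y\otimes U)\otimes V$ (with respect to $V$) and $\mathbf{tr}^V(f):X\otimes U\to Y\otimes U$ (with respect to $U$), and $$\mathbf{tr}^{U\otimes V}(f)=\mathbf{tr}^U\big(\mathbf{tr}^V(f)\big).$$
   Context: A Markov category is a symmetric monoidal category $(\mathbf C,\otimes,I)$ in which every object $X$ carries a commutative comonoid $\Delta_X:X\to X\otimes X$, $\mathrm{del}_X:X\to I$, compatible with $\otimes$, and every $f:X\to Y$ satisfies $\mathrm{del}_Y\circ f=\mathrm{del}_X$. Naturality of $\Delta$ is not assumed. Coherence isomorphisms are suppressed. $\mathbf C$ has conditionals if for every $f:A\to X\otimes Y$ there is $f|_X:X\otimes A\to Y$ with $f=(\mathrm{id}_X\otimes f|_X)\circ(\Delta_X\otimes\mathrm{id}_A)\circ\big(((\mathrm{id}_X\otimes\mathrm{del}_Y)\circ f)\otimes\mathrm{id}_A\big)\circ\Delta_A$. For $p:A\to X$ and $f_1,f_2:W\otimes X\to Y$, write $f_1=_pf_2$ if $(f_1\otimes\mathrm{id}_X)\circ(\mathrm{id}_W\otimes(\Delta_X\circ p))=(f_2\otimes\mathrm{id}_X)\circ(\mathrm{id}_W\otimes(\Delta_X\circ p))$. For $p:A\to X$, $q:B\to X$ write $p\ll q$ if for all $W,Y$ and $f_1,f_2:W\otimes X\to Y$, $f_1=_qf_2$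 implies $f_1=_pf_2$. $p:A\to X$ is atomic if $\Delta_X\circ p\ll p\otimes p$; $\mathbf C$ is atomic if all its morphisms are. An object $W$ is cancellable if $\mathrm{del}_W\otimes f_1=\mathrm{del}_W\otimes f_2$ implies $f_1=f_2$ for all parallel $f_1,f_2$; $\mathbf C$ is cancellative if all objects are cancellable. A morphism $f:X\otimes W'\to Y\otimes W$ is non-signalling (from $W'$ to $W$) if there is $f_s:X\to W$ with $(\mathrm{del}_Y\otimes\mathrm{id}_W)\circ f=f_s\otimes\mathrm{del}_{W'}$. A disintegration of $f$ is a pair $f_s:X\to W$, $f_p:X\otimes W\otimes W'\to Y$ with $f=(f_p\otimes\mathrm{id}_W)\circ(\mathrm{id}_{X\otimes W}\otimes\mathrm{swap}_{W,W'})\circ(s\otimes\mathrm{id}_{W'})$, where $s=(\mathrm{id}_X\otimes(\Delta_W\circ f_s))\circ\Delta_X:X\to X\otimes W\otimes W$. In a Markov category with conditionals, $f$ is non-signalling iff it has a disintegration. $f:X\otimes W\to Y\otimes W$ is called traceable (with respect to $W$) if it is non-signalling from the input $W$ to the output $W$; its causal trace is $\mathbf{tr}^W(f)=f_p\circ s:X\to Y$ for any disintegration (with $W'=W$); under the stated assumptions on $\mathbf C$ this does not depend on the choice of disintegration. *)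

(* Defs.v *)
(* Plain Rocq with ssreflect tactics (Stdlib world). *)
From Corelib Require Import ssreflect.
From Stdlib Require Import ClassicalEpsilon.

Set Implicit Arguments.
Unset Strict Implicit.
Unset Printing Implicit Defensive.

Declare Scope cat_scope.
Delimit Scope cat_scope with cat.
Local Open Scope cat_scope.

Record category := Category {
  obj :> Type;
  hom : obj -> obj -> Type;
  id : forall A, hom A A;
  comp : forall A B C, hom B C -> hom A B -> hom A C;
  comp_idl : forall A B (f : hom A B), comp (id B) f = f;
  comp_idr : forall A B (f : hom A B), comp f (id A) = f;
  comp_assoc : forall A B C D (h : hom C D) (g : hom B C) (f : hom A B),
    comp (comp h g) f = comp h (comp g f)
}.

Arguments id {c} A.
Arguments comp {c A B C} g f.

Notation "A ~> B" := (hom A B) (at level 99, B at level 200) : cat_scope.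
Notation "g ∘ f" := (comp g f) (at level 40, left associativity) : cat_scope.

Reserved Notation "A ⊗ B" (at level 34, left associativity).
Reserved Notation "f ⊠ g" (at level 34, left associativity).

Record monoidal_category := MonoidalCategory {
  moncat_category :> category;
  tensor : moncat_category -> moncat_category -> moncat_category
    where "A ⊗ B" := (tensor A B);
  tensor_hom : forall A B A' B' : moncat_category,
    (A ~> B) -> (A' ~> B') -> (A ⊗ A' ~> B ⊗ B')
    where "f ⊠ g" := (tensor_hom f g);
  munit : moncat_category;
  assoc : forall A B C : moncat_category, A ⊗ B ⊗ C ~> A ⊗ (B ⊗ C);
  assoc_inv : forall A B C : moncat_category, A ⊗ (B ⊗ C) ~> A ⊗ B ⊗ C;
  lunit : forall A : moncat_category, munit ⊗ A ~> A;
  lunit_inv : forall A : moncat_category, A ~> munit ⊗ A;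
  runit : forall A : moncat_category, A ⊗ munit ~> A;
  runit_inv : forall A : moncat_category, A ~> A ⊗ munit;
  tensor_id : forall A B : moncat_category, id A ⊠ id B = id (A ⊗ B);
  tensor_comp : forall (A B C A' B' C' : moncat_category)
      (g : B ~> C) (f : A ~> B) (g' : B' ~> C') (f' : A' ~> B'),
    (g ∘ f) ⊠ (g' ∘ f') = (g ⊠ g') ∘ (f ⊠ f');
  assoc_invl : forall A B C : moncat_category,
    assoc_inv A B C ∘ assoc A B C = id (A ⊗ B ⊗ C);
  assoc_invr : forall A B C : moncat_category,
    assoc A B C ∘ assoc_inv A B C = id (A ⊗ (B ⊗ C));
  lunit_invl : forall A : moncat_category,
    lunit_inv A ∘ lunit A = id (munit ⊗ A);
  lunit_invr : forall A : moncat_category, lunit A ∘ lunit_inv A = id A;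
  runit_invl : forall A : moncat_category,
    runit_inv A ∘ runit A = id (A ⊗ munit);
  runit_invr : forall A : moncat_category, runit A ∘ runit_inv A = id A;
  assoc_nat : forall (A B C A' B' C' : moncat_category)
      (f : A ~> A') (g : B ~> B') (h : C ~> C'),
    assoc A' B' C' ∘ (f ⊠ g ⊠ h) = (f ⊠ (g ⊠ h)) ∘ assoc A B C;
  lunit_nat : forall (A B : moncat_category) (f : A ~> B),
    lunit B ∘ (id munit ⊠ f) = f ∘ lunit A;
  runit_nat : forall (A B : moncat_category) (f : A ~> B),
    runit B ∘ (f ⊠ id munit) = f ∘ runit A;
  triangle : forall A B : moncat_category,
    (id A ⊠ lunit B) ∘ assoc A munit B = runit A ⊠ id B;
  pentagon : forall A B C D : moncat_category,
    assoc A B (C ⊗ D) ∘ assoc (A ⊗ B) C D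
    = (id A ⊠ assoc B C D) ∘ (assoc A (B ⊗ C) D ∘ (assoc A B C ⊠ id D))
}.

Arguments tensor {m} A B.
Arguments tensor_hom {m A B A' B'} f g.
Arguments munit {m}.
Arguments assoc {m} A B C.
Arguments assoc_inv {m} A B C.
Arguments lunit {m} A.
Arguments lunit_inv {m} A.
Arguments runit {m} A.
Arguments runit_inv {m} A.

Notation "A ⊗ B" := (tensor A B) : cat_scope.
Notation "f ⊠ g" := (tensor_hom f g) : cat_scope.

Record symmetric_monoidal_category := SymmetricMonoidalCategory {
  symcat_moncat :> monoidal_category;
  swap : forall A B : symcat_moncat, A ⊗ B ~> B ⊗ A;
  swap_nat : forall (A B A' B' : symcat_moncat) (f : A ~> A') (g : B ~> B'),
    swap A' B' ∘ (f ⊠ g) = (g ⊠ f) ∘ swap A B;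
  swap_swap : forall A B : symcat_moncat, swap B A ∘ swap A B = id (A ⊗ B);
  lunit_swap : forall A : symcat_moncat, lunit A ∘ swap A munit = runit A;
  hexagon : forall A B C : symcat_moncat,
    assoc B C A ∘ (swap A (B ⊗ C) ∘ assoc A B C)
    = (id B ⊠ swap A C) ∘ (assoc B A C ∘ (swap A B ⊠ id C))
}.

Arguments swap {s} A B.

(* The canonical isomorphism exchanging the two inner factors. *)
Definition interchange (M : symmetric_monoidal_category) (A B C D : M) :
    (A ⊗ B) ⊗ (C ⊗ D) ~> (A ⊗ C) ⊗ (B ⊗ D) :=
  assoc_inv A C (B ⊗ D)
  ∘ (id A ⊠ (assoc C B D ∘ (swap B C ⊠ id D) ∘ assoc_inv B C D))
  ∘ assoc A B (C ⊗ D).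

(* Compatibility of the comonoids with the unit object, [del munit = id munit]
   and [copy munit = lunit_inv munit], follows from the axioms below. *)
Record markov_category := MarkovCategory {
  markov_symcat :> symmetric_monoidal_category;
  copy : forall A : markov_symcat, A ~> A ⊗ A;
  del : forall A : markov_symcat, A ~> munit;
  copy_assoc : forall A : markov_symcat,
    assoc A A A ∘ ((copy A ⊠ id A) ∘ copy A) = (id A ⊠ copy A) ∘ copy A;
  copy_lunit : forall A : markov_symcat,
    lunit A ∘ ((del A ⊠ id A) ∘ copy A) = id A;
  copy_runit : forall A : markov_symcat,
    runit A ∘ ((id A ⊠ del A) ∘ copy A) = id A;
  copy_swap : forall A : markov_symcat, swap A A ∘ copy A = copy A;
  copy_tensor : forall A B : markov_symcat,
    copy (A ⊗ B) = interchange A A B B ∘ (copy A ⊠ copy B);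
  del_tensor : forall A B : markov_symcat,
    del (A ⊗ B) = lunit munit ∘ (del A ⊠ del B);
  del_nat : forall (A B : markov_symcat) (f : A ~> B), del B ∘ f = del A
}.

Arguments copy {m} A.
Arguments del {m} A.

Definition has_conditionals (M : markov_category) : Prop :=
  forall (A X Y : M) (f : A ~> X ⊗ Y),
  exists c : X ⊗ A ~> Y,
    f = (id X ⊠ c) ∘ assoc X X A ∘ (copy X ⊠ id A)
        ∘ ((runit X ∘ (id X ⊠ del Y) ∘ f) ⊠ id A) ∘ copy A.

Definition as_equal (M : markov_category) (A X W Y : M) (p : A ~> X)
    (f1 f2 : W ⊗ X ~> Y) : Prop :=
  (f1 ⊠ id X) ∘ assoc_inv W X X ∘ (id W ⊠ (copy X ∘ p))
  = (f2 ⊠ id X) ∘ assoc_inv W X X ∘ (id W ⊠ (copy X ∘ p)).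

Definition abs_continuous (M : markov_category) (A B X : M)
    (p : A ~> X) (q : B ~> X) : Prop :=
  forall (W Y : M) (f1 f2 : W ⊗ X ~> Y),
    as_equal q f1 f2 -> as_equal p f1 f2.

Definition atomic_hom (M : markov_category) (A X : M) (p : A ~> X) : Prop :=
  abs_continuous (copy X ∘ p) (p ⊠ p).

Definition atomic (M : markov_category) : Prop :=
  forall (A X : M) (p : A ~> X), atomic_hom p.

Definition cancellable (M : markov_category) (W : M) : Prop :=
  forall (A B : M) (f1 f2 : A ~> B), del W ⊠ f1 = del W ⊠ f2 -> f1 = f2.

Definition cancellative (M : markov_category) : Prop :=
  forall W : M, cancellable W.

Definition non_signalling (M : markov_category) (X Y W' W : M)
    (f : X ⊗ W' ~> Y ⊗ W) : Prop :=
  exists fs : X ~> W,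
    lunit W ∘ (del Y ⊠ id W) ∘ f = runit W ∘ (fs ⊠ del W').

Definition copy_signal (M : markov_category) (X W : M) (fs : X ~> W) :
    X ~> X ⊗ W ⊗ W :=
  assoc_inv X W W ∘ (id X ⊠ (copy W ∘ fs)) ∘ copy X.

Definition is_disintegration (M : markov_category) (X Y W' W : M)
    (f : X ⊗ W' ~> Y ⊗ W) (fs : X ~> W) (fp : X ⊗ W ⊗ W' ~> Y) : Prop :=
  f = (fp ⊠ id W) ∘ assoc_inv (X ⊗ W) W' W ∘ (id (X ⊗ W) ⊠ swap W W')
      ∘ assoc (X ⊗ W) W W' ∘ (copy_signal fs ⊠ id W').

Definition traceable (M : markov_category) (X Y W : M)
    (f : X ⊗ W ~> Y ⊗ W) : Prop :=
  non_signalling f.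

Section Coherence.
Context (M : symmetric_monoidal_category).
Implicit Types A B C D X Y Z W : M.

Lemma precomp A B C (g h : B ~> C) : g = h -> forall f : A ~> B, g ∘ f = h ∘ f.
Proof. by move=> ->. Qed.

Lemma precomp1 A B (g : B ~> A) (h : A ~> B) :
  g ∘ h = id A -> forall C (f : C ~> A), g ∘ (h ∘ f) = f.
Proof. by move=> e C f; rewrite -comp_assoc e comp_idl. Qed.

Lemma precomp2 A B B' C (g : B ~> C) (h : A ~> B) (g' : B' ~> C) (h' : A ~> B') :
  g ∘ h = g' ∘ h' -> forall D (f : D ~> A), g ∘ (h ∘ f) = g' ∘ (h' ∘ f).
Proof. by move=> e D f; rewrite -!comp_assoc e. Qed.

Lemma tensor_compl A B C X (g : B ~> C) (f : A ~> B) :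
  (g ∘ f) ⊠ id X = (g ⊠ id X) ∘ (f ⊠ id X).
Proof. by rewrite -tensor_comp comp_idl. Qed.

Lemma tensor_compr A B C X (g : B ~> C) (f : A ~> B) :
  id X ⊠ (g ∘ f) = (id X ⊠ g) ∘ (id X ⊠ f).
Proof. by rewrite -tensor_comp comp_idl. Qed.

Lemma tensor_exchange A B C D (f : A ~> B) (g : C ~> D) :
  (f ⊠ id D) ∘ (id A ⊠ g) = (id B ⊠ g) ∘ (f ⊠ id C).
Proof. by rewrite -!tensor_comp !comp_idl !comp_idr. Qed.

Lemma assoc_inv_nat A B C A' B' C' (f : A ~> A') (g : B ~> B') (h : C ~> C') :
  assoc_inv A' B' C' ∘ (f ⊠ (g ⊠ h)) = (f ⊠ g ⊠ h) ∘ assoc_inv A B C.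
Proof.
have e := precomp (assoc_nat f g h) (assoc_inv A B C).
rewrite !comp_assoc assoc_invr comp_idr in e.
by rewrite -e (precomp1 (assoc_invl _ _ _)).
Qed.

Lemma assoc_inv_natl A A' B C (f : A ~> A') :
  assoc_inv A' B C ∘ (f ⊠ id (B ⊗ C)) = (f ⊠ id B ⊠ id C) ∘ assoc_inv A B C.
Proof. by rewrite -tensor_id assoc_inv_nat. Qed.

Lemma assoc_natl A A' B C (f : A ~> A') :
  assoc A' B C ∘ (f ⊠ id B ⊠ id C) = (f ⊠ id (B ⊗ C)) ∘ assoc A B C.
Proof. by rewrite -tensor_id assoc_nat. Qed.

Lemma assoc_natr A B C C' (f : C ~> C') :
  assoc A B C' ∘ (id (A ⊗ B) ⊠ f) = (id A ⊠ (id B ⊠ f)) ∘ assoc A B C.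
Proof. by rewrite -tensor_id assoc_nat. Qed.

Lemma lunit_faithful A B (f g : A ~> B) :
  id (@munit M) ⊠ f = id munit ⊠ g -> f = g.
Proof.
move=> e; rewrite -(comp_idr f) -(comp_idr g) -lunit_invr -!comp_assoc.
by rewrite -!lunit_nat e.
Qed.

Lemma assoc_epi A B C D (f g : A ⊗ (B ⊗ C) ~> D) :
  f ∘ assoc A B C = g ∘ assoc A B C -> f = g.
Proof.
move=> /precomp /(_ (assoc_inv A B C)).
by rewrite !comp_assoc assoc_invr !comp_idr.
Qed.

Lemma lunit_assoc A B : lunit (A ⊗ B) ∘ assoc munit A B = lunit A ⊠ id B.
Proof.
apply: lunit_faithful; apply: assoc_epi.
have inv : (assoc munit munit A ⊠ id B) ∘ (assoc_inv munit munit A ⊠ id B)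
    = id (munit ⊗ (munit ⊗ A) ⊗ B).
  by rewrite -tensor_compl assoc_invr tensor_id.
rewrite -(comp_idr (_ ∘ assoc _ _ _)) -(comp_idr ((_ ⊠ (_ ⊠ _)) ∘ _)) -inv.
rewrite -!(comp_assoc _ (assoc munit munit A ⊠ id B)); congr (_ ∘ _).
rewrite tensor_compr !comp_assoc -pentagon -comp_assoc triangle.
rewrite -assoc_natl -triangle tensor_compl.
by rewrite -comp_assoc assoc_nat comp_assoc.
Qed.

Lemma pentagon_inv A B C D :
  assoc_inv A (B ⊗ C) D ∘ ((id A ⊠ assoc_inv B C D) ∘ assoc A B (C ⊗ D))
  = (assoc A B C ⊠ id D) ∘ assoc_inv (A ⊗ B) C D.
Proof.
have e := precomp (pentagon A B C D) (assoc_inv (A ⊗ B) C D).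
rewrite !comp_assoc assoc_invr comp_idr in e.
rewrite e -(comp_assoc (id A ⊠ _) (id A ⊠ _)) -tensor_compr assoc_invl.
by rewrite tensor_id comp_idl (precomp1 (assoc_invl _ _ _)).
Qed.

Lemma swap_tensorr A B C :
  swap A (B ⊗ C)
  = assoc_inv B C A ∘ ((id B ⊠ swap A C)
      ∘ (assoc B A C ∘ ((swap A B ⊠ id C) ∘ assoc_inv A B C))).
Proof.
have e := precomp (hexagon A B C) (assoc_inv A B C).
rewrite !comp_assoc assoc_invr comp_idr in e.
by rewrite -e (precomp1 (assoc_invl _ _ _)).
Qed.

Lemma swap_tensorl A B X :
  (swap X A ⊠ id B) ∘ (assoc_inv X A B ∘ swap (A ⊗ B) X)
  = assoc_inv A X B ∘ ((id A ⊠ swap B X) ∘ assoc A B X).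
Proof.
have e : (id A ⊠ swap B X) ∘ (id A ⊠ swap X B) = id (A ⊗ (X ⊗ B)).
  by rewrite -tensor_compr swap_swap tensor_id.
have h := precomp (hexagon X A B) (assoc_inv X A B ∘ swap (A ⊗ B) X).
rewrite !comp_assoc (precomp1 (assoc_invr _ _ _)) swap_swap comp_idr in h.
by rewrite h (precomp1 e) (precomp1 (assoc_invl _ _ _)).
Qed.

Lemma shuffle A B X Z :
  swap B (A ⊗ (X ⊗ Z))
  ∘ (assoc B A (X ⊗ Z) ∘ ((swap A B ⊠ id (X ⊗ Z)) ∘ assoc (A ⊗ B) X Z))
  = ((assoc A X Z ∘ (swap X A ⊠ id Z)) ⊠ id B)
    ∘ (assoc_inv (X ⊗ A) Z B ∘ ((id (X ⊗ A) ⊠ swap B Z)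
    ∘ (assoc (X ⊗ A) B Z ∘ ((assoc_inv X A B ∘ swap (A ⊗ B) X) ⊠ id Z)))).
Proof.
have eR : forall Y (k : Y ~> X ⊗ A ⊗ B ⊗ Z),
    ((assoc A X Z ∘ (swap X A ⊠ id Z)) ⊠ id B)
    ∘ (assoc_inv (X ⊗ A) Z B ∘ ((id (X ⊗ A) ⊠ swap B Z)
    ∘ (assoc (X ⊗ A) B Z ∘ k)))
    = (assoc A X Z ⊠ id B) ∘ (assoc_inv (A ⊗ X) Z B ∘ ((id (A ⊗ X) ⊠ swap B Z)
    ∘ (assoc (A ⊗ X) B Z ∘ ((swap X A ⊠ id B ⊠ id Z) ∘ k)))).
  move=> Y k; rewrite tensor_compl !comp_assoc.
  rewrite -(precomp2 (assoc_inv_natl _ _ _)) (precomp2 (tensor_exchange _ _)).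
  by rewrite -(precomp2 (assoc_natl _ _ _)).
rewrite eR -tensor_compl swap_tensorl.
rewrite (swap_tensorr B A) !comp_assoc (precomp1 (assoc_invl _ _ _)).
have e : (swap B A ⊠ id (X ⊗ Z)) ∘ (swap A B ⊠ id (X ⊗ Z))
    = id (A ⊗ B ⊗ (X ⊗ Z)) by rewrite -tensor_compl swap_swap tensor_id.
rewrite (precomp1 e) pentagon (swap_tensorr B X) !tensor_compr !comp_assoc.
have e1 : (id A ⊠ assoc_inv B X Z) ∘ (id A ⊠ assoc B X Z)
    = id (A ⊗ (B ⊗ X ⊗ Z)) by rewrite -tensor_compr assoc_invl tensor_id.
rewrite (precomp1 e1) -(precomp2 (assoc_nat _ _ _)) !tensor_compl.
set k := (_ ∘ (assoc A B X ⊠ id Z)).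
have p : (id A ⊠ assoc X B Z) ∘ assoc A (X ⊗ B) Z
    = assoc A X (B ⊗ Z) ∘ (assoc (A ⊗ X) B Z ∘ (assoc_inv A X B ⊠ id Z)).
  rewrite -comp_assoc pentagon !comp_assoc -tensor_compl assoc_invr.
  by rewrite tensor_id comp_idr.
rewrite -(comp_assoc _ (assoc A (X ⊗ B) Z)) p !comp_assoc.
rewrite -(precomp2 (assoc_natr _ _ _)).
have q := precomp (pentagon_inv A X Z B).
rewrite -(comp_assoc _ (assoc A X (Z ⊗ B))).
by rewrite -(comp_assoc (assoc_inv A (X ⊗ Z) B)) q !comp_assoc.
Qed.

Lemma interchange_lunit W X Z :
  (runit W ⊠ id (X ⊗ Z))
  ∘ (interchange W X munit Z ∘ (id (W ⊗ X) ⊠ lunit_inv Z))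
  = assoc W X Z.
Proof.
have t : (runit W ⊠ id (X ⊗ Z)) ∘ assoc_inv W munit (X ⊗ Z)
    = id W ⊠ lunit (X ⊗ Z).
  by rewrite -triangle comp_assoc assoc_invr comp_idr.
have u : lunit (X ⊗ Z)
    ∘ (assoc munit X Z ∘ (swap X munit ⊠ id Z) ∘ assoc_inv X munit Z)
    = id X ⊠ lunit Z.
  rewrite -!comp_assoc lunit_assoc -tensor_compl lunit_swap -triangle.
  by rewrite comp_assoc assoc_invr comp_idr.
rewrite /interchange -!comp_assoc t !comp_assoc.
rewrite -(comp_assoc (id W ⊠ _) (id W ⊠ _)) -tensor_compr -!comp_assoc.
rewrite !comp_assoc in u *; rewrite u -(precomp2 (assoc_natr _ _ _)).
by rewrite -tensor_compr lunit_invr tensor_id comp_idr.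
Qed.

Lemma interchange_nat A B C D A' B' C' D'
    (a : A ~> A') (b : B ~> B') (c : C ~> C') (d : D ~> D') :
  ((a ⊠ c) ⊠ (b ⊠ d)) ∘ interchange A B C D
  = interchange A' B' C' D' ∘ ((a ⊠ b) ⊠ (c ⊠ d)).
Proof.
rewrite /interchange !comp_assoc assoc_nat -(precomp2 (assoc_inv_nat _ _ _)).
rewrite -!(comp_assoc (id _ ⊠ _)) -!(comp_assoc (_ ⊠ _) (_ ⊠ _)) -!tensor_comp.
rewrite comp_idl comp_idr !comp_assoc assoc_inv_nat.
rewrite -(comp_assoc (swap B' C' ⊠ id D')) -tensor_comp swap_nat comp_idl.
rewrite -(comp_idr d) tensor_comp comp_idr -(precomp2 (assoc_nat _ _ _)).
by rewrite !comp_assoc.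
Qed.

Lemma runit_swap A : runit A ∘ swap munit A = lunit A.
Proof. by rewrite -lunit_swap comp_assoc swap_swap comp_idr. Qed.

End Coherence.

Lemma copy_marginal (M : markov_category) (X W W' : M) (fs : X ~> W) :
  ((runit W ∘ (fs ⊠ del W')) ⊠ id (X ⊗ W')) ∘ copy (X ⊗ W')
  = assoc W X W' ∘ (((fs ⊠ id X) ∘ copy X) ⊠ id W').
Proof.
have e : (del W' ⊠ id W') ∘ copy W' = lunit_inv W'.
  by rewrite -[RHS]comp_idr -[in RHS](copy_lunit W') (precomp1 (lunit_invl _)).
rewrite copy_tensor tensor_compl comp_assoc -(tensor_id X W').
rewrite -(comp_assoc ((fs ⊠ _) ⊠ _)) interchange_nat comp_assoc -tensor_comp e.
rewrite -(interchange_lunit W X W') tensor_id !comp_assoc -tensor_comp.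
by rewrite comp_idl comp_idr.
Qed.

Lemma disintegration_exists (M : markov_category) (hM : has_conditionals M)
    (X Y W' W : M) (f : X ⊗ W' ~> Y ⊗ W) :
  non_signalling f ->
  exists (fs : X ~> W) (fp : X ⊗ W ⊗ W' ~> Y), is_disintegration f fs fp.
Proof.
case=> fs ns; have [c e] := hM _ _ _ (swap Y W ∘ f).
have m : runit W ∘ (id W ⊠ del Y) ∘ (swap Y W ∘ f) = runit W ∘ (fs ⊠ del W').
  rewrite -ns -runit_swap !comp_assoc; congr (_ ∘ _).
  by rewrite -!comp_assoc swap_nat.
rewrite m !comp_assoc copy_marginal in e.
exists fs, (c ∘ (assoc W X W' ∘ (swap X W ⊠ id W'))).
rewrite /is_disintegration /copy_signal.
have -> : f = swap W Y ∘ (swap Y W ∘ f).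
  by rewrite -comp_assoc swap_swap comp_idl.
rewrite e (precomp2 (swap_nat _ _)) -{1}copy_swap tensor_compl !comp_assoc.
rewrite -(precomp2 (assoc_natl _ _ _)).
rewrite -(comp_assoc (swap W W ⊠ _)) -(comp_assoc (assoc _ _ _) (_ ∘ _)).
rewrite -(comp_assoc (swap _ _)) shuffle (tensor_compl _ c) !comp_assoc.
do 5! congr (_ ∘ _).
rewrite -!tensor_compl; congr (_ ⊠ _); rewrite !comp_assoc; congr (_ ∘ _).
by rewrite !(precomp2 (swap_nat _ _)) copy_swap tensor_compr comp_assoc.
Qed.

Definition is_causal_trace (M : markov_category) (X Y W : M)
    (f : X ⊗ W ~> Y ⊗ W) (t : X ~> Y) : Prop :=
  exists (fs : X ~> W) (fp : X ⊗ W ⊗ W ~> Y),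
    is_disintegration f fs fp /\ t = fp ∘ copy_signal fs.

Lemma causal_trace_exists (M : markov_category) (hM : has_conditionals M)
    (X Y W : M) (f : X ⊗ W ~> Y ⊗ W) :
  traceable f -> exists t, is_causal_trace f t.
Proof.
move=> /(disintegration_exists hM) [fs [fp d]].
by exists (fp ∘ copy_signal fs), fs, fp.
Qed.

(* The trace computed from a chosen disintegration; the choice is immaterial
   when [M] is moreover atomic and cancellative. *)
Definition causal_trace (M : markov_category) (hM : has_conditionals M)
    (X Y W : M) (f : X ⊗ W ~> Y ⊗ W) (hf : traceable f) : X ~> Y :=
  proj1_sig (constructive_indefinite_description _ (causal_trace_exists hM hf)).

(* Main.v *)
Require Import Defs.

(** Pairing with marginal projections makes the deterministic morphisms a
    cartesian category, so that composites of structural maps are compared by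
    their components; a general morphism becomes a program whose sampling steps
    are [⟨id, m⟩]. By cancellativity the signal [fs] of a disintegration is
    determined by [f]. The remaining part [fp] is determined only almost surely
    with respect to [(x, w)] for [w] drawn from [fs x], with the input [w']
    independent of [w]. Atomicity, applied to [p = ⟨id, fs⟩], says that the
    diagonal of [p] is absolutely continuous with respect to [p ⊠ p], which
    allows [w' = w] and shows the trace to be well defined. For associativity,
    sample [(u, v)] from [fs] in either order by conditionals:
    [v] first gives a disintegration for the inner trace, and [u] first gives
    one for the outer trace. *)

Local Open Scope cat_scope.

(** * Pairing, projections and determinism *)

Definition pairing {M : markov_category} {A X Y : M} (f : A ~> X) (g : A ~> Y) :
  A ~> X ⊗ Y := (f ⊠ g) ∘ copy A.

Definition proj_l {M : markov_category} (A B : M) : A ⊗ B ~> A :=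
  runit A ∘ (id A ⊠ del B).

Definition proj_r {M : markov_category} (A B : M) : A ⊗ B ~> B :=
  lunit B ∘ (del A ⊠ id B).

Definition deterministic {M : markov_category} {A B : M} (f : A ~> B) : Prop :=
  copy B ∘ f = pairing f f.

Arguments proj_l {M A B}.
Arguments proj_r {M A B}.

Notation "⟨ f , g ⟩" := (pairing f g) (at level 0, f, g at level 99) : cat_scope.

(** * Coherence laws for the tensor unit *)

Section Units.
Context (M : symmetric_monoidal_category).
Implicit Types A B C D : M.

Lemma runit_faithful A B (f g : A ~> B) :
  f ⊠ id (@munit M) = g ⊠ id munit -> f = g.
Proof.
  intros e.
  rewrite <- (comp_idr f), <- (comp_idr g), <- runit_invr, <- !comp_assoc.
  now rewrite <- !runit_nat, e.
Qed.

Lemma assoc_monic A B C D (f g : D ~> A ⊗ B ⊗ C) :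
  assoc A B C ∘ f = assoc A B C ∘ g -> f = g.
Proof.
  intros e. rewrite <- (comp_idl f), <- (comp_idl g), <- assoc_invl.
  now rewrite !comp_assoc, e.
Qed.

(** Kelly's argument: tensoring with the unit on the right is faithful and associators are monic,
    which reduces the equation to the pentagon and the triangle. *)
Lemma runit_assoc A B :
  (id A ⊠ runit B) ∘ assoc A B munit = runit (A ⊗ B).
Proof.
  apply runit_faithful, assoc_monic.
  rewrite <- triangle, tensor_compl.
  rewrite <- comp_assoc, assoc_nat, comp_assoc.
  rewrite <- triangle, tensor_compr, comp_assoc.
  rewrite <- pentagon, <- comp_assoc, <- assoc_natr, comp_assoc.
  reflexivity.
Qed.

Lemma lunit_assoc_inv A B : (lunit A ⊠ id B) ∘ assoc_inv munit A B = lunit (A ⊗ B).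
Proof. now rewrite <- lunit_assoc, comp_assoc, assoc_invr, comp_idr. Qed.

Lemma interchange_runit A B D :
  (id (A ⊗ B) ⊠ lunit D) ∘ interchange A munit B D
  = assoc_inv A B D ∘ (runit A ⊠ id (B ⊗ D)).
Proof.
  unfold interchange. rewrite <- !comp_assoc, <- tensor_id, <- assoc_inv_nat.
  rewrite !comp_assoc. f_equal. rewrite <- triangle, <- !comp_assoc. f_equal.
  rewrite <- tensor_compr. f_equal. rewrite <- !comp_assoc, triangle.
  now rewrite <- tensor_compl, runit_swap, lunit_assoc_inv.
Qed.

End Units.

(** * Cartesian calculus of deterministic morphisms *)

Section Pairing.
Context (M : markov_category).
Implicit Types A B C X Y Z W : M.

Lemma tensor_pairing A X Y X' Y' (f : X ~> X') (g : Y ~> Y')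
    (a : A ~> X) (b : A ~> Y) :
  (f ⊠ g) ∘ ⟨a, b⟩ = ⟨f ∘ a, g ∘ b⟩.
Proof. unfold pairing. now rewrite <- comp_assoc, <- tensor_comp. Qed.

Lemma pairing_idl A X Y (a : A ~> X) (b : A ~> Y) :
  ⟨a, b⟩ = (a ⊠ id Y) ∘ ⟨id A, b⟩.
Proof. now rewrite tensor_pairing, comp_idl, comp_idr. Qed.

Lemma proj_l_tensor A B A' B' (f : A ~> A') (g : B ~> B') :
  proj_l ∘ (f ⊠ g) = f ∘ proj_l.
Proof.
  unfold proj_l. rewrite <- comp_assoc, <- runit_nat, !comp_assoc, <- !tensor_comp.
  now rewrite !comp_idl, comp_idr, del_nat.
Qed.

Lemma proj_r_tensor A B A' B' (f : A ~> A') (g : B ~> B') :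
  proj_r ∘ (f ⊠ g) = g ∘ proj_r.
Proof.
  unfold proj_r. rewrite <- comp_assoc, <- lunit_nat, !comp_assoc, <- !tensor_comp.
  now rewrite !comp_idl, comp_idr, del_nat.
Qed.

Lemma proj_l_pairing A X Y (a : A ~> X) (b : A ~> Y) : proj_l ∘ ⟨a, b⟩ = a.
Proof.
  unfold pairing. rewrite <- comp_assoc, proj_l_tensor, comp_assoc.
  unfold proj_l. now rewrite comp_assoc, copy_runit, comp_idr.
Qed.

Lemma proj_r_pairing A X Y (a : A ~> X) (b : A ~> Y) : proj_r ∘ ⟨a, b⟩ = b.
Proof.
  unfold pairing. rewrite <- comp_assoc, proj_r_tensor, comp_assoc.
  unfold proj_r. now rewrite comp_assoc, copy_lunit, comp_idr.
Qed.

Lemma assoc_pairing A X Y Z (a : A ~> X) (b : A ~> Y) (c : A ~> Z) :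
  assoc X Y Z ∘ ⟨⟨a, b⟩, c⟩ = ⟨a, ⟨b, c⟩⟩.
Proof.
  unfold pairing. rewrite <- (comp_idr c) at 1. rewrite <- (comp_idr a) at 2.
  rewrite !tensor_comp, !comp_assoc, <- copy_assoc, <- !comp_assoc.
  now rewrite assoc_nat.
Qed.

Lemma assoc_inv_pairing A X Y Z (a : A ~> X) (b : A ~> Y) (c : A ~> Z) :
  assoc_inv X Y Z ∘ ⟨a, ⟨b, c⟩⟩ = ⟨⟨a, b⟩, c⟩.
Proof. now rewrite <- assoc_pairing, (precomp1 (assoc_invl _ _ _)). Qed.

Lemma swap_pairing A X Y (a : A ~> X) (b : A ~> Y) : swap X Y ∘ ⟨a, b⟩ = ⟨b, a⟩.
Proof. unfold pairing. now rewrite <- comp_assoc, swap_nat, comp_assoc, copy_swap. Qed.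

Lemma copy_pairing A : copy A = ⟨id A, id A⟩.
Proof. unfold pairing. now rewrite tensor_id, comp_idl. Qed.

Lemma interchange_pairing A X Y Z W
    (a : A ~> X) (b : A ~> Y) (c : A ~> Z) (d : A ~> W) :
  interchange X Y Z W ∘ ⟨⟨a, b⟩, ⟨c, d⟩⟩ = ⟨⟨a, c⟩, ⟨b, d⟩⟩.
Proof.
  unfold interchange.
  rewrite !comp_assoc, assoc_pairing, tensor_pairing, !comp_assoc.
  rewrite assoc_inv_pairing, tensor_pairing, swap_pairing, !comp_idl.
  now rewrite assoc_pairing, assoc_inv_pairing.
Qed.

(** The copy of [B] that [proj_l] discards cancels by the counit law, so only [A] is duplicated. *)
Lemma pairing_proj_l_id A B :
  ⟨proj_l, id (A ⊗ B)⟩ = assoc A A B ∘ (copy A ⊠ id B).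
Proof.
  unfold pairing, proj_l. rewrite copy_marginal, tensor_id.
  now rewrite comp_idl.
Qed.

Lemma pairing_id_proj_r A B :
  ⟨id (A ⊗ B), proj_r⟩ = assoc_inv A B B ∘ (id A ⊠ copy B).
Proof.
  unfold pairing, proj_r.
  rewrite copy_tensor, tensor_compr, !comp_assoc, <- tensor_id.
  rewrite <- (comp_assoc _ (interchange A A B B)).
  rewrite interchange_nat, <- !comp_assoc, tensor_id, interchange_runit.
  rewrite !comp_assoc, <- !tensor_comp. rewrite copy_runit.
  now rewrite !tensor_id, !comp_idl.
Qed.

Lemma pairing_proj A B : ⟨proj_l, proj_r⟩ = id (A ⊗ B).
Proof.
  rewrite <- (comp_idl proj_l), <- (comp_idr proj_r), <- tensor_pairing.
  rewrite pairing_proj_l_id. unfold proj_r.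
  rewrite tensor_compr, <- comp_assoc, !comp_assoc.
  rewrite <- (comp_assoc (id A ⊠ (del A ⊠ id B))), <- assoc_nat.
  rewrite <- !comp_assoc, triangle, <- !tensor_compl, comp_assoc.
  now rewrite copy_runit, tensor_id.
Qed.

Lemma deterministic_id A : deterministic (id A).
Proof. unfold deterministic. now rewrite comp_idr, copy_pairing. Qed.

Lemma pairing_deterministic A B X Y (a : B ~> X) (b : B ~> Y) (d : A ~> B) :
  deterministic d -> ⟨a, b⟩ ∘ d = ⟨a ∘ d, b ∘ d⟩.
Proof.
  intros e. rewrite <- tensor_pairing, <- e. apply comp_assoc.
Qed.

Lemma deterministic_comp A B C (g : B ~> C) (f : A ~> B) :
  deterministic g -> deterministic f -> deterministic (g ∘ f).
Proof.
  intros hg hf. unfold deterministic.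
  now rewrite <- comp_assoc, hg, pairing_deterministic.
Qed.

Lemma deterministic_pairing A X Y (f : A ~> X) (g : A ~> Y) :
  deterministic f -> deterministic g -> deterministic ⟨f, g⟩.
Proof.
  intros hf hg. unfold deterministic.
  rewrite copy_tensor, comp_assoc, tensor_pairing, hf, hg.
  apply interchange_pairing.
Qed.

Lemma deterministic_proj_l A B : deterministic (@proj_l M A B).
Proof.
  unfold deterministic.
  rewrite <- (comp_idl proj_l) at 2. rewrite <- (comp_idr proj_l) at 3.
  rewrite <- tensor_pairing, pairing_proj_l_id. unfold proj_l.
  rewrite tensor_compr, <- comp_assoc, !comp_assoc.
  rewrite <- (comp_assoc (id A ⊠ (id A ⊠ del B))), <- assoc_nat.
  rewrite <- !comp_assoc, runit_assoc, tensor_id, <- runit_nat.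
  rewrite !comp_assoc, <- !tensor_comp. now rewrite !comp_idl, !comp_idr.
Qed.

Lemma deterministic_proj_r A B : deterministic (@proj_r M A B).
Proof.
  unfold deterministic.
  rewrite <- (comp_idl proj_r) at 3. rewrite <- (comp_idr proj_r) at 2.
  rewrite <- tensor_pairing, pairing_id_proj_r. unfold proj_r.
  rewrite tensor_compl, <- comp_assoc, !comp_assoc.
  rewrite <- (comp_assoc ((del A ⊠ id B) ⊠ id B)), <- assoc_inv_nat.
  rewrite <- !comp_assoc, lunit_assoc_inv, tensor_id, <- lunit_nat.
  rewrite !comp_assoc, <- !tensor_comp. now rewrite !comp_idl, !comp_idr.
Qed.

(** A general [f] may correlate its two outputs, whereas the pairing of its marginals runs it twice
    independently; determinism removes the difference. *)
Lemma pairing_eta A B C (f : A ~> B ⊗ C) :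
  deterministic f -> ⟨proj_l ∘ f, proj_r ∘ f⟩ = f.
Proof.
  intros hf. now rewrite <- pairing_deterministic, pairing_proj, comp_idl.
Qed.

(** This and the next three lemmas turn structural maps into pairings of projections, the form in
    which composites are compared. *)
Lemma tensor_proj A B A' B' (f : A ~> A') (g : B ~> B') :
  f ⊠ g = ⟨f ∘ proj_l, g ∘ proj_r⟩.
Proof. now rewrite <- tensor_pairing, pairing_proj, comp_idr. Qed.

Lemma swap_proj A B : swap A B = ⟨proj_r, proj_l⟩.
Proof. now rewrite <- swap_pairing, pairing_proj, comp_idr. Qed.

Lemma assoc_proj A B C :
  assoc A B C = ⟨proj_l ∘ proj_l, ⟨proj_r ∘ proj_l, proj_r⟩⟩.
Proof.
  rewrite <- assoc_pairing, pairing_eta by apply deterministic_proj_l.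
  now rewrite pairing_proj, comp_idr.
Qed.

Lemma assoc_inv_proj A B C :
  assoc_inv A B C = ⟨⟨proj_l, proj_l ∘ proj_r⟩, proj_r ∘ proj_r⟩.
Proof.
  rewrite <- assoc_inv_pairing, pairing_eta by apply deterministic_proj_r.
  now rewrite pairing_proj, comp_idr.
Qed.

(* Sampling [m] commutes with running [a], which does not use its result. *)
Lemma pairing_bind_r A B X Y (a : A ~> X) (b : A ⊗ B ~> Y) (m : A ~> B) :
  ⟨a ∘ proj_l, b⟩ ∘ ⟨id A, m⟩ = ⟨a, b ∘ ⟨id A, m⟩⟩.
Proof.
  rewrite <- (comp_idr b) at 1.
  rewrite <- tensor_pairing, pairing_proj_l_id, !comp_assoc, tensor_pairing.
  rewrite comp_idl, comp_idr, copy_pairing, assoc_pairing, tensor_pairing.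
  now rewrite comp_idr.
Qed.

Lemma pairing_bind_l A B X Y (a : A ~> X) (b : A ⊗ B ~> Y) (m : A ~> B) :
  ⟨b, a ∘ proj_l⟩ ∘ ⟨id A, m⟩ = ⟨b ∘ ⟨id A, m⟩, a⟩.
Proof.
  now rewrite <- swap_pairing, comp_assoc, pairing_bind_r, swap_pairing.
Qed.

End Pairing.

(* Normalisation of composites by components *)
Create HintDb det.
#[local] Hint Resolve deterministic_id deterministic_comp deterministic_pairing
  deterministic_proj_l deterministic_proj_r : det.

Lemma proj_l_pairing_comp (M : markov_category) (Z A X Y : M)
    (a : A ~> X) (b : A ~> Y) (h : Z ~> A) : proj_l ∘ (⟨a, b⟩ ∘ h) = a ∘ h.
Proof. now rewrite <- comp_assoc, proj_l_pairing. Qed.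

Lemma proj_r_pairing_comp (M : markov_category) (Z A X Y : M)
    (a : A ~> X) (b : A ~> Y) (h : Z ~> A) : proj_r ∘ (⟨a, b⟩ ∘ h) = b ∘ h.
Proof. now rewrite <- comp_assoc, proj_r_pairing. Qed.

(* Equational theory of cartesian products, with pairing distributing only over
   deterministic morphisms. *)
Ltac cart_step :=
  first
  [ rewrite comp_assoc | rewrite comp_idl | rewrite comp_idr
  | rewrite proj_l_pairing | rewrite proj_r_pairing
  | rewrite proj_l_pairing_comp | rewrite proj_r_pairing_comp
  | rewrite pairing_proj
  | match goal with
    | |- context [pairing ?a ?b ∘ ?d] =>
        rewrite (pairing_deterministic _ _ _ _ _ a b d) by auto 20 with det
    | |- context [pairing ?a ?b ∘ (?d ∘ ?h)] =>
        rewrite <- (comp_assoc ⟨a, b⟩ d h);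
        rewrite (pairing_deterministic _ _ _ _ _ a b d) by auto 20 with det
    | |- context [pairing (proj_l ∘ ?f) (proj_r ∘ ?f)] =>
        rewrite (pairing_eta _ _ _ _ f) by auto 20 with det
    end ].
Ltac cart := repeat cart_step.

(** * Disintegrations and uniqueness of the trace *)

Section Traces.
Context (M : markov_category).
Implicit Types A B C U V W X Y Z : M.

Lemma copy_signal_pairing X W (fs : X ~> W) :
  copy_signal fs = ⟨id (X ⊗ W), proj_r⟩ ∘ ⟨id X, fs⟩.
Proof.
  unfold copy_signal. rewrite pairing_id_proj_r, copy_pairing, !comp_assoc.
  rewrite !tensor_pairing, !comp_idl. reflexivity.
Qed.

(** Program form: on [(x, w')], [w] is drawn from [fs x] and [(fp(x, w, w'), w)] is returned. *)
Lemma disintegration_pairing X Y W' W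
    (f : X ⊗ W' ~> Y ⊗ W) (fs : X ~> W) (fp : X ⊗ W ⊗ W' ~> Y) :
  is_disintegration f fs fp <->
  f = ⟨fp ∘ ⟨⟨proj_l ∘ proj_l, proj_r⟩, proj_r ∘ proj_l⟩, proj_r⟩
      ∘ ⟨id (X ⊗ W'), fs ∘ proj_l⟩.
Proof.
  assert (e : ⟨id X, fs⟩ ⊠ id W'
    = ⟨⟨proj_l ∘ proj_l, proj_r⟩, proj_r ∘ proj_l⟩
      ∘ ⟨id (X ⊗ W'), fs ∘ proj_l⟩).
  { rewrite pairing_bind_l, pairing_bind_r, tensor_proj. now cart. }
  unfold is_disintegration.
  rewrite copy_signal_pairing, tensor_compl, e.
  rewrite assoc_inv_proj, assoc_proj, swap_proj, !tensor_proj.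
  cart. reflexivity.
Qed.

Lemma as_equal_pairing A X W Y (p : A ~> X) (f1 f2 : W ⊗ X ~> Y) :
  as_equal p f1 f2 <->
  ⟨f1, proj_r⟩ ∘ (id W ⊠ p) = ⟨f2, proj_r⟩ ∘ (id W ⊠ p).
Proof.
  assert (e : forall f : W ⊗ X ~> Y,
    (f ⊠ id X) ∘ assoc_inv W X X ∘ (id W ⊠ (copy X ∘ p))
    = ⟨f, proj_r⟩ ∘ (id W ⊠ p)).
  { intros f. rewrite tensor_compr, (pairing_idl _ _ _ _ f), pairing_id_proj_r.
    now rewrite !comp_assoc. }
  unfold as_equal. now rewrite !e.
Qed.

Lemma proj_l_epi X Z W (f g : X ~> Z) :
  cancellable W -> f ∘ @proj_l _ X W = g ∘ proj_l -> f = g.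
Proof.
  intros hW e. apply hW. rewrite !tensor_proj.
  (* Precomposing with the swap moves the discarded factor to the left, where [hW] applies. *)
  assert (e' : f ∘ @proj_r _ W X = g ∘ proj_r).
  { rewrite <- (proj_l_pairing _ _ _ _ proj_r (@proj_l _ W X)).
    now rewrite <- !comp_assoc, e. }
  now rewrite e'.
Qed.

Lemma disintegration_signal X Y W' W
    (f : X ⊗ W' ~> Y ⊗ W) (fs : X ~> W) (fp : X ⊗ W ⊗ W' ~> Y) :
  is_disintegration f fs fp -> proj_r ∘ f = fs ∘ proj_l.
Proof. intros ->%disintegration_pairing. now cart. Qed.

Lemma disintegration_non_signalling X Y W' W
    (f : X ⊗ W' ~> Y ⊗ W) (fs : X ~> W) (fp : X ⊗ W ⊗ W' ~> Y) :
  is_disintegration f fs fp -> non_signalling f.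
Proof.
  intros e%disintegration_signal. exists fs.
  unfold proj_r, proj_l in e. rewrite e, <- comp_assoc, <- runit_nat, comp_assoc.
  now rewrite <- tensor_comp, comp_idl, comp_idr.
Qed.

(* The right-hand side obtains [w] and [y = fp(x, w, w')] by calling [f], so the
   left-hand side depends only on [f] and not on its disintegration. *)
Lemma pair_with_independent_signal X W Y (fs : X ~> W) (fp : X ⊗ W ⊗ W ~> Y) f :
  is_disintegration f fs fp ->
  ⟨fp ∘ ⟨proj_l, proj_r ∘ proj_r⟩ ∘ proj_r, proj_r⟩
  ∘ (id X ⊠ (⟨id X, fs⟩ ⊠ id (X ⊗ W)))
  = (id Y ⊠ ⟨⟨proj_l ∘ proj_r ∘ proj_r, proj_l⟩, proj_r ∘ proj_r ∘ proj_r⟩)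
    ∘ (assoc Y W (X ⊗ (X ⊗ (X ⊗ W)))
    ∘ ⟨f ∘ ⟨proj_l ∘ proj_r, proj_r ∘ (proj_r ∘ proj_r)⟩, id _⟩).
Proof.
  intros ->%disintegration_pairing.
  (* Both sides are brought to the form of a morphism after [⟨id, m⟩]; this common sampling step
     then cancels. *)
  set (m := fs ∘ (proj_l ∘ @proj_r _ X (X ⊗ (X ⊗ W)))).
  assert (e : id X ⊠ (⟨id X, fs⟩ ⊠ id (X ⊗ W))
    = ⟨proj_l ∘ proj_l, ⟨⟨proj_l ∘ proj_r ∘ proj_l, proj_r⟩,
         proj_r ∘ proj_r ∘ proj_l⟩⟩ ∘ ⟨id _, m⟩).
  { rewrite pairing_bind_r, pairing_bind_l, pairing_bind_r, !tensor_proj.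
    now cart. }
  rewrite e. clear e.
  set (d := ⟨proj_l ∘ proj_r, proj_r ∘ (proj_r ∘ proj_r)⟩).
  assert (e : ⟨id (X ⊗ W), fs ∘ proj_l⟩ ∘ d
    = ⟨d ∘ proj_l, proj_r⟩ ∘ ⟨id (X ⊗ (X ⊗ (X ⊗ W))), m⟩).
  { rewrite pairing_bind_r. unfold d, m. now cart. }
  rewrite (comp_assoc _ _ d), e, <- !(comp_assoc _ _ ⟨id _, m⟩), <- pairing_bind_l.
  unfold d. rewrite comp_idl.
  rewrite <- !comp_assoc. f_equal.
  cart.
  rewrite assoc_pairing, tensor_pairing. now cart.
Qed.

Lemma causal_trace_unique X Y W (f : X ⊗ W ~> Y ⊗ W) (t t' : X ~> Y) :
  atomic M -> cancellable W ->
  is_causal_trace f t -> is_causal_trace f t' -> t = t'.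
Proof.
  intros hM hW [fs [fp [d ->]]] [fs' [fp' [d' ->]]].
  assert (e : fs = fs').
  { apply (proj_l_epi _ _ W); trivial.
    now rewrite <- (disintegration_signal _ _ _ _ _ _ _ d),
      <- (disintegration_signal _ _ _ _ _ _ _ d'). }
  subst fs'. set (p := ⟨id X, fs⟩).
  (* On the pairs [(x, w)] and [(x', w')], [g h] runs [h] on [(x, w, w')]; under [p ⊠ p] the value
     [w'] is independent of [w]. *)
  set (g := fun h : X ⊗ W ⊗ W ~> Y =>
    h ∘ ⟨proj_l, proj_r ∘ proj_r⟩ ∘ @proj_r _ X (X ⊗ W ⊗ (X ⊗ W))).
  assert (h : as_equal (p ⊠ p) (g fp) (g fp')).
  { apply as_equal_pairing.
    (* The second [p] runs first and supplies [w']; the first is absorbed into a call of [f], which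
       is the same for both disintegrations. *)
    assert (e : p ⊠ p = (p ⊠ id (X ⊗ W)) ∘ (id X ⊠ p))
      by now rewrite <- tensor_comp, comp_idl, comp_idr.
    rewrite e, tensor_compr, <- !comp_assoc. f_equal. unfold g, p.
    now rewrite (pair_with_independent_signal _ _ _ _ _ _ d),
      (pair_with_independent_signal _ _ _ _ _ _ d'). }
  apply hM, as_equal_pairing in h.
  (* On the diagonal of [p] the two pairs coincide, so [w' = w] and [g k] computes the trace. *)
  assert (e : forall k : X ⊗ W ⊗ W ~> Y, k ∘ copy_signal fs
    = proj_l ∘ (⟨g k, proj_r⟩ ∘ (id X ⊠ (copy (X ⊗ W) ∘ p)) ∘ copy X)).
  { intros k. rewrite copy_signal_pairing, !copy_pairing. unfold g.
    rewrite comp_assoc, tensor_pairing.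
    fold p. rewrite proj_l_pairing_comp, !comp_assoc, proj_r_pairing. now cart. }
  now rewrite !e, h.
Qed.

(** * Two-stage sampling and iterated traces *)

Lemma conditional_on_l A X Y (f : A ~> X ⊗ Y) :
  has_conditionals M ->
  exists c : A ⊗ X ~> Y, f = ⟨proj_r, c⟩ ∘ ⟨id A, proj_l ∘ f⟩.
Proof.
  intros hM. destruct (hM _ _ _ f) as [c e]. exists (c ∘ ⟨proj_r, proj_l⟩).
  rewrite e at 1. clear e. rewrite (comp_assoc (id X ⊠ c)).
  rewrite <- pairing_proj_l_id, tensor_pairing, comp_idl, comp_idr, comp_assoc.
  fold (@proj_l M X Y). fold (pairing (proj_l ∘ f) (id A)).
  rewrite <- (swap_pairing _ _ _ _ (id A)), swap_proj, <- comp_assoc.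
  now cart.
Qed.

Lemma conditional_on_r A X Y (f : A ~> X ⊗ Y) :
  has_conditionals M ->
  exists c : A ⊗ Y ~> X, f = ⟨c, proj_r⟩ ∘ ⟨id A, proj_r ∘ f⟩.
Proof.
  intros hM. destruct (conditional_on_l _ _ _ (swap X Y ∘ f) hM) as [c e].
  exists c. rewrite <- swap_pairing, comp_assoc.
  assert (e' : proj_l ∘ (swap X Y ∘ f) = proj_r ∘ f)
    by (rewrite swap_proj; now rewrite <- comp_assoc, proj_l_pairing).
  rewrite e' in e. rewrite <- e.
  now rewrite <- comp_assoc, swap_swap, comp_idl.
Qed.

(** The output of [d] is both kept and used for sampling; determinism allows [d] to be run once for
    each use. *)
Lemma bind_comp A B C (m : B ~> C) (d : A ~> B) :
  deterministic d ->
  ⟨id B, m⟩ ∘ d = ⟨d ∘ proj_l, proj_r⟩ ∘ ⟨id A, m ∘ d⟩.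
Proof. intros hd. rewrite pairing_bind_r. now cart. Qed.

(** [e] extracts the argument of [f] from a context [B], which is kept because later steps still
    read its other variables. *)
Lemma sample_r_first A B X Y (f : A ~> X ⊗ Y) (c : A ⊗ Y ~> X) (e : B ~> A) :
  deterministic e -> f = ⟨c, proj_r⟩ ∘ ⟨id A, proj_r ∘ f⟩ ->
  ⟨id B, f ∘ e⟩
  = ⟨proj_l ∘ proj_l, ⟨proj_r, proj_r ∘ proj_l⟩⟩
    ∘ ⟨id (B ⊗ Y), c ∘ ⟨e ∘ proj_l, proj_r⟩⟩ ∘ ⟨id B, proj_r ∘ f ∘ e⟩.
Proof.
  intros he hf. rewrite pairing_bind_r, pairing_bind_l.
  rewrite proj_r_pairing, <- (comp_idl proj_l), pairing_bind_r. f_equal.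
  rewrite hf at 1.
  rewrite comp_assoc, bind_comp, <- comp_assoc by trivial. now cart.
Qed.

Lemma sample_l_first A B X Y (f : A ~> X ⊗ Y) (c : A ⊗ X ~> Y) (e : B ~> A) :
  deterministic e -> f = ⟨proj_r, c⟩ ∘ ⟨id A, proj_l ∘ f⟩ ->
  ⟨id B, f ∘ e⟩
  = ⟨proj_l ∘ proj_l, ⟨proj_r ∘ proj_l, proj_r⟩⟩
    ∘ ⟨id (B ⊗ X), c ∘ ⟨e ∘ proj_l, proj_r⟩⟩ ∘ ⟨id B, proj_l ∘ f ∘ e⟩.
Proof.
  intros he hf. rewrite pairing_bind_r, pairing_bind_r.
  rewrite proj_r_pairing, <- (comp_idl proj_l), pairing_bind_r. f_equal.
  rewrite hf at 1.
  rewrite comp_assoc, bind_comp, <- comp_assoc by trivial. now cart.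
Qed.

(** The sampled [v] is fed back as input: on [(x, u')], the trace draws [(u, v)] from [fs x] and
    returns [(fp(x, (u, v), (u', v)), u)]. A disintegration along [V] must draw [v] first, hence the
    conditional on [V]. *)
Lemma inner_causal_trace X Y U V (f : X ⊗ (U ⊗ V) ~> Y ⊗ (U ⊗ V))
    (fs : X ~> U ⊗ V) (fp : X ⊗ (U ⊗ V) ⊗ (U ⊗ V) ~> Y) :
  has_conditionals M -> is_disintegration f fs fp ->
  is_causal_trace (assoc_inv Y U V ∘ f ∘ assoc X U V)
    (⟨fp ∘ ⟨⟨proj_l ∘ proj_l, proj_r⟩,
            ⟨proj_r ∘ proj_l, proj_r ∘ proj_r⟩⟩, proj_l ∘ proj_r⟩
     ∘ ⟨id (X ⊗ U), fs ∘ proj_l⟩).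
Proof.
  intros hM hd. destruct (conditional_on_r _ _ _ fs hM) as [c hc].
  exists (proj_r ∘ fs ∘ proj_l).
  (* On [(x, u', v, v')], [u] is drawn from [c(x, v)] and [(fp(x, (u, v), (u', v')), u)] is
     returned. *)
  exists (⟨fp ∘ ⟨⟨proj_l ∘ proj_l ∘ proj_l ∘ proj_l,
                  ⟨proj_r, proj_r ∘ proj_l ∘ proj_l⟩⟩,
                 ⟨proj_r ∘ proj_l ∘ proj_l ∘ proj_l, proj_r ∘ proj_l⟩⟩, proj_r⟩
    ∘ ⟨id (X ⊗ U ⊗ V ⊗ V),
       c ∘ ⟨proj_l ∘ proj_l ∘ proj_l, proj_r ∘ proj_l⟩⟩).
  split.
  - apply disintegration_pairing in hd. apply disintegration_pairing. subst f.
    assert (ea : ⟨id (X ⊗ (U ⊗ V)), fs ∘ proj_l⟩ ∘ assoc X U V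
      = ⟨assoc X U V ∘ proj_l, proj_r⟩
        ∘ ⟨id (X ⊗ U ⊗ V), fs ∘ (proj_l ∘ proj_l)⟩)
      by (rewrite assoc_proj, bind_comp by auto with det; now cart).
    rewrite (comp_assoc _ _ (assoc X U V)), (comp_assoc _ _ (assoc X U V)), ea.
    rewrite (sample_r_first _ _ _ _ fs c) by auto with det.
    (* [D] exchanges [v'] and [v]; being deterministic, it moves past the sampling of [u]. *)
    set (D := ⟨⟨@proj_l _ (X ⊗ U) V ∘ proj_l, @proj_r _ _ V⟩, proj_r ∘ proj_l⟩).
    rewrite (comp_assoc _ _ D), (bind_comp _ _ _ _ D) by (unfold D; auto 20 with det).
    rewrite <- !comp_assoc, <- pairing_bind_l.
    unfold D. rewrite assoc_proj. cart.
    now rewrite <- comp_assoc, assoc_inv_pairing.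
  - rewrite copy_signal_pairing.
    rewrite (comp_assoc _ _ (_ ∘ _)), <- (comp_assoc ⟨id _, _⟩), bind_comp by auto with det.
    rewrite <- comp_assoc.
    rewrite (sample_r_first _ _ _ _ fs c) by auto with det.
    now cart.
Qed.

(** Here the signal is [u], so [u] is drawn first and [v] from the conditional on it. Setting
    [u' = u] then gives [fp] the same pair [(u, v)] twice, as in the trace along [U ⊗ V]. *)
Lemma outer_causal_trace X Y U V
    (fs : X ~> U ⊗ V) (fp : X ⊗ (U ⊗ V) ⊗ (U ⊗ V) ~> Y) :
  has_conditionals M ->
  is_causal_trace
    (⟨fp ∘ ⟨⟨proj_l ∘ proj_l, proj_r⟩,
            ⟨proj_r ∘ proj_l, proj_r ∘ proj_r⟩⟩, proj_l ∘ proj_r⟩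
     ∘ ⟨id (X ⊗ U), fs ∘ proj_l⟩)
    (fp ∘ copy_signal fs).
Proof.
  intros hM. destruct (conditional_on_l _ _ _ fs hM) as [c hc].
  exists (proj_l ∘ fs).
  (* On [(x, u, u')], [v] is drawn from [c(x, u)] and [fp(x, (u, v), (u', v))] is returned. *)
  exists (fp ∘ ⟨⟨proj_l ∘ proj_l ∘ proj_l, ⟨proj_r ∘ proj_l ∘ proj_l, proj_r⟩⟩,
               ⟨proj_r ∘ proj_l, proj_r⟩⟩
    ∘ ⟨id (X ⊗ U ⊗ U), c ∘ proj_l⟩).
  split.
  - apply disintegration_pairing.
    rewrite (sample_l_first _ _ _ _ fs c) by auto with det.
    set (D := ⟨⟨@proj_l _ X U ∘ proj_l, @proj_r _ _ U⟩, proj_r ∘ proj_l⟩).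
    rewrite (comp_assoc _ _ D), (bind_comp _ _ _ _ D) by (unfold D; auto 20 with det).
    rewrite <- !comp_assoc, <- pairing_bind_l.
    unfold D. now cart.
  - rewrite !copy_signal_pairing.
    assert (e := sample_l_first _ _ _ _ fs c (id X) (deterministic_id _ _) hc).
    rewrite !comp_idr in e. rewrite e.
    rewrite !comp_assoc, <- (comp_assoc ⟨id _, c ∘ proj_l⟩).
    rewrite (bind_comp _ _ _ _ ⟨id _, proj_r⟩) by auto with det.
    now cart.
Qed.

End Traces.

Theorem proposition22 (C : markov_category) (hcond : has_conditionals C)
    (hatom : atomic C) (hcanc : cancellative C) (X Y U V : C)
    (f : X ⊗ (U ⊗ V) ~> Y ⊗ (U ⊗ V)) (hf : traceable f) :
  exists (hV : traceable (assoc_inv Y U V ∘ f ∘ assoc X U V))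
         (hU : traceable (causal_trace hcond hV)),
    causal_trace hcond hf = causal_trace hcond hU.
Proof.
  assert (traceable_trace : forall (A B W : C) (g : A ⊗ W ~> B ⊗ W) t,
    is_causal_trace g t -> traceable g).
  { intros A B W g t [gs [gp [d _]]].
    exact (disintegration_non_signalling _ _ _ _ _ _ _ _ d). }
  (* By uniqueness, the chosen trace may be computed from any disintegration. *)
  assert (traceE : forall (A B W : C) (g : A ⊗ W ~> B ⊗ W) (hg : traceable g) t,
    is_causal_trace g t -> causal_trace hcond hg = t).
  { intros A B W g hg t ht.
    apply (causal_trace_unique C _ _ W g); auto.
    unfold causal_trace. apply proj2_sig. }
  destruct (disintegration_exists hcond hf) as [fs [fp d]].
  assert (hi := inner_causal_trace _ _ _ _ _ _ _ _ hcond d).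
  assert (ho := outer_causal_trace _ _ _ _ _ fs fp hcond).
  exists (traceable_trace _ _ _ _ _ hi).
  (* [ho] concerns the explicit program; it is transported to the chosen inner trace, the morphism
     whose traceability [hU] must assert. *)
  rewrite <- (traceE _ _ _ _ (traceable_trace _ _ _ _ _ hi) _ hi) in ho.
  exists (traceable_trace _ _ _ _ _ ho).
  rewrite (traceE _ _ _ _ (traceable_trace _ _ _ _ _ ho) _ ho).
  apply traceE. now exists fs, fp.
Qed.
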